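(* Let $k \geq 3$ be an integer. There is a constant $C_k$, depending only on $k$, such that for any nonzero integers $a_1, \dots, a_k$ and any $N$, there is a finite set $S \subseteq \mathbb{Z}$ with $|S| \geq N$ and $$T(S) \geq \frac{\sigma_k}{k^{k-1}}|S|^{k-1} - C_k|S|^{k-2}.$$ (That is, for any equation $a_1x_1+\dots+a_kx_k=0$ there are arbitrarily large sets $S$ for which $T(S) \geq \frac{\sigma_k}{k^{k-1}}|S|^{k-1} + O(|S|^{k-2})$.)
   Context: For a finite set $S \subseteq \mathbb{Z}$, $T(S)$ denotes the number of $k$-tuples $(x_1,\dots,x_k) \in S^k$ with $a_1x_1+\dots+a_kx_k=0$. For $x>0$, $I_x : \mathbb{R} \to \mathbb{R}$ is the indicator function of the interval of length $x$ centred at the origin: $I_x(y)=1$ if $|y| \leq x/2$ and $I_x(y)=0$ otherwise. For $k\geq 3$, $\sigma_k = (I_1 \ast \dots \ast I_1)(0)$, the $k$-fold convolution on $\mathbb{R}$ evaluated at $0$; equivalently $\sigma_k = \int_{-\infty}^{\infty} \left(\frac{\sin \pi x}{\pi x}\right)^k dx$. *)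

(* Defs.v *)
From HB Require Import structures.
From mathcomp Require Import all_boot all_order all_algebra.
From mathcomp Require Import finmap.
From mathcomp Require Import all_classical all_reals all_analysis.

Set Implicit Arguments.
Unset Strict Implicit.
Unset Printing Implicit Defensive.

Import Order.TTheory GRing.Theory Num.Theory.
Import numFieldNormedType.Exports.
Local Open Scope ring_scope.

(* The elements of S^k are the finite functions from 'I_k to the finite type
   of elements of S. *)
Definition num_solutions (k : nat) (a : 'I_k -> int) (S : {fset int}) : nat :=
  #|[pred x : {ffun 'I_k -> S} | \sum_(i < k) a i * val (x i) == 0]|.

Definition centred_indicator (R : realType) (x : R) : R -> R :=
  \1_[set y : R | `|y| <= x / 2]%classic.

Definition convolution (R : realType) (f g : R -> R) : R -> R :=
  fun x => \int[@lebesgue_measure R]_t (f t * g (x - t)).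

(* The k-fold convolution f * (f * (... * f)) with k factors, for 1 <= k
   (the case k = 0 is junk and gives f). *)
Definition iter_convolution (R : realType) (k : nat) (f : R -> R) : R -> R :=
  iter k.-1 (convolution f) f.

Definition sigma (R : realType) (k : nat) : R :=
  iter_convolution k (centred_indicator 1) 0.

(* Main.v *)
(* Let A be the product of the a_i and S the union of the dilates
   (A / a_i) * [-L, L], so that |S| <= k (2 L + 1).  A tuple
   x_i = (A / a_i) y_i solves the equation as soon as the y_i sum to 0.  To
   count such y, round the k - 1 variables of the k-fold convolution, rescaled
   by n = 2 M + 1, to the nearest integers: this loses at most 1/2 per
   variable, so sigma_k n^(k-1) is at most the number of y in [-M, M]^(k-1)
   with |sum y| <= M + k/2.  Taking L = M + k, the last coordinate - sum y
   fits in [-L, L], and n^(k-1) and (2 L + 1)^(k-1) differ by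
   O((2 L + 1)^(k-2)). *)

Require Import Defs.
From HB Require Import structures.
From mathcomp Require Import all_boot all_order all_algebra.
From mathcomp Require Import finmap.
From mathcomp Require Import all_classical all_reals all_analysis.
From mathcomp Require Import measurable_realfun.
From mathcomp Require Import zify ring lra.

Set Implicit Arguments.
Unset Strict Implicit.
Unset Printing Implicit Defensive.

Import Order.TTheory GRing.Theory Num.Theory.
Local Open Scope ring_scope.

(** * Bounding integrals by step functions *)

Lemma centred_indicatorE (R : realType) (c x : R) :
  centred_indicator c x = (`|x| <= c / 2)%R%:R.
Proof.
rewrite /centred_indicator indicE; congr (_%:R); congr nat_of_bool.
by apply/idP/idP; rewrite inE.
Qed.

(* Proved from the supremum definition instead of [ge0_le_integral], to avoid
   showing the iterated convolutions measurable. *)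
Lemma ge0_le_integralT d (T : measurableType d) (R : realType)
    (mu : measure T R) (f g : T -> \bar R) :
  (forall x, 0 <= f x)%E -> (forall x, f x <= g x)%E ->
  (\int[mu]_x f x <= \int[mu]_x g x)%E.
Proof.
move=> f0 fg; rewrite !ge0_integralTE //; last first.
  by move=> x; apply: le_trans (f0 x) (fg x).
apply: ereal_sup_le => _ [h hf <-]; exists h => //= x.
exact: le_trans (hf x) (fg x).
Qed.

(** The function [f] lies pointwise below the sum of the [c i] times the indicators of the
    intervals, which is measurable even if [f] is not. The intervals may overlap, because every term
    of that sum is nonnegative. *)
Lemma Rintegral_le_steps (R : realType) (I : finType) (f : R -> R)
    (lo hi c : I -> R) :
  (forall t, 0 <= f t) -> (forall i, lo i <= hi i) -> (forall i, 0 <= c i) ->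
  (forall t, f t != 0 -> exists2 i, lo i <= t <= hi i & f t <= c i) ->
  \int[@lebesgue_measure R]_t f t <= \sum_i c i * (hi i - lo i).
Proof.
move=> f0 lohi c0 fc.
pose ind i t : \bar R := (\1_(`[lo i, hi i]%classic) t)%:E.
have ind0 i t : (0 <= ind i t)%E by rewrite lee_fin indicE ler0n.
have mind i : measurable_fun [set: R]%classic (ind i).
  apply/measurable_EFinP; exact: measurable_indic.
have intind i : (\int[@lebesgue_measure R]_t ind i t = (hi i - lo i)%:E)%E.
  rewrite /ind integral_indic //= setIT lebesgue_measure_itv /= lte_fin.
  case: ltP => // h; have -> : hi i = lo i by apply/eqP; rewrite eq_le h lohi.
  by rewrite subrr.
have le_step : (\int[@lebesgue_measure R]_t (f t)%:E
    <= (\sum_i c i * (hi i - lo i))%:E)%E.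
  apply: (@le_trans _ _ (\int[@lebesgue_measure R]_t
      (\sum_i (c i)%:E * ind i t))%E).
    apply: ge0_le_integralT => t; first by rewrite lee_fin.
    have [->|/fc [i tI fi]] := eqVneq (f t) 0.
      by apply: sume_ge0 => i _; rewrite mule_ge0 ?lee_fin.
    rewrite (bigD1 i) //= -[leLHS]adde0 leeD //; last first.
      by apply: sume_ge0 => j _; rewrite mule_ge0 ?lee_fin.
    by rewrite /ind indicE mem_set ?mule1 ?lee_fin //= in_itv.
  rewrite ge0_integral_sum //; last 2 first.
  - by move=> i; apply: measurable_funeM; apply: mind.
  - by move=> i t _; rewrite mule_ge0 ?lee_fin.
  rewrite -sumEFin lee_sum // => i _.
  by rewrite ge0_integralZl_EFin // ?intind -?EFinM //; apply: mind.
have ge0 : (0 <= \int[@lebesgue_measure R]_t (f t)%:E)%E.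
  by apply: integral_ge0 => t _; rewrite lee_fin.
rewrite /Rintegral -lee_fin fineK // ge0_fin_numE //.
exact: le_lt_trans le_step (ltry _).
Qed.

(** * Rounding the convolution to a lattice point count *)

Lemma exists_unit_step (R : realType) (M : nat) (z : R) :
  `|z| <= (2 * M + 1)%:R / 2 ->
  exists y : 'I_(2 * M + 1), `|z - (y%:R - M%:R)| <= 1 / 2.
Proof.
rewrite ler_norml => /andP[z1 z2].
have zM : 0 <= z + M%:R + 1 / 2.
  by move: z1; rewrite natrD natrM; lra.
have /andP[t1 t2] := truncn_itv zM.
set t := Num.truncn _ in t1 t2.
(* Rounding leaves the index range only at the right endpoint z = M + 1/2, where the last index 2 M
   is still at distance 1/2. *)
have [tM|tM] := ltnP t (2 * M + 1).
  exists (Ordinal tM) => /=.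
  by rewrite ler_norml; move: t1 t2; rewrite -(natr1 t); lra.
have lt2 : (2 * M < 2 * M + 1)%N by lia.
exists (Ordinal lt2) => /=.
have : (2 * M + 1)%:R <= t%:R :> R by rewrite ler_nat.
by rewrite ler_norml; move: z1 z2 t1; rewrite natrD natrM; lra.
Qed.

Definition centred_sum (R : pzRingType) (M n j : nat) (t : j.-tuple 'I_n) : R :=
  \sum_(i < j) ((tnth t i)%:R - M%:R).

(** The centre [x] and the width [w] are real, because each convolution moves the centre by a real
    amount and widens the window by 1/2. *)
Definition near_count (R : realType) (M j : nat) (w x : R) : nat :=
  (\sum_(t : j.-tuple 'I_(2 * M + 1)) (`|x - centred_sum R M t| <= w)%R)%N.

Lemma near_countS (R : realType) (M j : nat) (w x : R) :
  near_count M j.+1 w x =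
  (\sum_(y < 2 * M + 1) near_count M j w (x - (y%:R - M%:R)))%N.
Proof.
rewrite /near_count pair_big /=.
rewrite (reindex (fun p : 'I_(2 * M + 1) * j.-tuple 'I_(2 * M + 1) =>
  [tuple of p.1 :: p.2])) /=; last first.
  exists (fun t => (thead t, [tuple of behead t])) => [[y t] _|t _] /=.
    by congr pair; apply: val_inj.
  by rewrite [RHS]tuple_eta.
apply: eq_bigr => -[y t] _ /=; congr (nat_of_bool (`|_| <= _)%R).
rewrite /centred_sum big_ord_recl opprD addrA tnth0.
by congr (_ - _); apply: eq_bigr => i _; rewrite tnthS.
Qed.

Lemma le_near_count (R : realType) (M j : nat) (w w' x x' : R) :
  `|x - x'| <= w' - w -> (near_count M j w x <= near_count M j w' x')%N.
Proof.
move=> xx'; apply: leq_sum => t _.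
have [le_w|//] := boolP (`|x - _| <= w)%R.
rewrite (_ : `|x' - _| <= w') //; move: xx' le_w.
by rewrite !ler_norml => /andP[? ?] /andP[? ?]; apply/andP; split; lra.
Qed.

(** By induction on [j]: the support of the new factor is cut into [n] intervals of length 1/n
    around the points (y - M)/n. On each of them the rescaled argument is within 1/2 of its value at
    the centre, so a window wider by 1/2 suffices. Nonnegativity is carried along because the step
    function bound requires it. *)
Lemma iter_convolution_le_near_count (R : realType) (M j : nat) (x : R) :
  let n := (2 * M + 1)%N in
  let g := iter j (convolution (centred_indicator 1)) (centred_indicator 1) in
  0 <= g x /\
  n%:R ^+ j * g x <= (near_count M j ((n + j)%:R / 2) (n%:R * x))%:R.
Proof.
move=> n g; rewrite {}/g.
have n0 : 0 < n%:R :> R by rewrite ltr0n /n addn1.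
elim: j x => [|j IH] x /=.
  rewrite centred_indicatorE ler0n; split=> //.
  rewrite expr0 mul1r ler_nat /near_count (big_pred1 [tuple]) /=; last first.
    by move=> t; apply/esym/eqP; rewrite tuple0.
  rewrite /centred_sum big_ord0 subr0 addn0.
  have [xle|//] := boolP (`|x| <= _)%R.
  by rewrite normrM gtr0_norm // ler_pM2l // -[_^-1]mul1r xle.
set g := iter j _ _ in IH *.
have fg0 t : 0 <= centred_indicator 1 t * g (x - t).
  by rewrite mulr_ge0 ?(IH _).1 // centred_indicatorE.
split; first by apply: Rintegral_ge0 => t _; exact: fg0.
pose w : R := (n + j.+1)%:R / 2.
pose v (y : 'I_n) : R := y%:R - M%:R.
have nj0 : 0 < n%:R ^+ j :> R by rewrite exprn_gt0.
have steps := @Rintegral_le_steps R 'I_n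
  (fun t => centred_indicator 1 t * g (x - t))
  (fun y => (v y - 1 / 2) / n%:R) (fun y => (v y + 1 / 2) / n%:R)
  (fun y => (near_count M j w (n%:R * x - v y))%:R / n%:R ^+ j) fg0.
apply: le_trans
  (ler_wpM2l (ltW (exprn_gt0 j.+1 n0)) (steps _ _ _)) _.
- by move=> y; rewrite ler_pM2r ?invr_gt0 //; lra.
- by move=> y; rewrite divr_ge0 ?ler0n // ltW.
- move=> t; rewrite centred_indicatorE.
  have [tle|] := boolP (`|t| <= _)%R; last by rewrite mul0r eqxx.
  move=> _.
  have [|y ynear] := @exists_unit_step R M (n%:R * t).
    by rewrite normrM gtr0_norm // ler_pM2l // -[_^-1]mul1r.
  exists y.
    rewrite ler_pdivrMr // ler_pdivlMr // mulrC.
    move: ynear; rewrite ler_norml -/(v y) => /andP[? ?].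
    by apply/andP; split; lra.
  rewrite [true%:R * _]mul1r ler_pdivlMr // mulrC; apply: le_trans (IH _).2 _.
  rewrite ler_nat; apply: le_near_count.
  rewrite (_ : _ - _ = - (n%:R * t - (y%:R - M%:R))); last by rewrite /v; ring.
  rewrite normrN (le_trans ynear) // /w addnS -(natr1 (n + j)); lra.
(* Each interval contributes its count times (1/n) / n^j, which the factor n^(j+1) cancels
   exactly. *)
rewrite near_countS natr_sum mulr_sumr ler_sum // => y _.
rewrite exprS le_eqVlt; apply/orP; left; apply/eqP.
by rewrite -/(v y) -/w; field; rewrite !gt_eqF.
Qed.

(** * The union of dilates and its solutions *)

Definition coprod (k : nat) (a : 'I_k -> int) (i : 'I_k) : int :=
  \prod_(l | l != i) a l.

Definition dilates (k : nat) (a : 'I_k -> int) (L : nat) : {fset int} :=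
  [fset x in [seq coprod a i * (y%:Z - L%:Z) | i <- enum 'I_k,
                                              y <- iota 0 (2 * L + 1)]]%fset.

Lemma mul_coprod (k : nat) (a : 'I_k -> int) (i : 'I_k) :
  a i * coprod a i = \prod_l a l.
Proof. by rewrite [RHS](bigD1 i). Qed.

Lemma coprod_neq0 (k : nat) (a : 'I_k -> int) (i : 'I_k) :
  (forall l, a l != 0) -> coprod a i != 0.
Proof. by move=> a0; apply/prodf_neq0 => l _. Qed.

Lemma mem_dilates (k : nat) (a : 'I_k -> int) (L : nat) (i : 'I_k) (z : int) :
  `|z| <= L%:Z -> coprod a i * z \in dilates a L.
Proof.
move=> zL; rewrite in_fset /=; apply/allpairsP.
exists (i, absz (z + L%:Z)) => /=.
split; [by rewrite mem_enum | by rewrite mem_iota; lia | congr (_ * _); lia].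
Qed.

Lemma card_dilates_le (k : nat) (a : 'I_k -> int) (L : nat) :
  (#|` dilates a L| <= k * (2 * L + 1))%N.
Proof.
rewrite card_fseq (leq_trans (size_undup _)) // size_allpairs size_iota.
by rewrite -cardE card_ord.
Qed.

(** A single dilate already has 2 L + 1 elements, its factor being nonzero. *)
Lemma card_dilates_ge (k : nat) (a : 'I_k -> int) (L : nat) :
  (0 < k)%N -> (forall l, a l != 0) -> (2 * L + 1 <= #|` dilates a L|)%N.
Proof.
move=> k0 a0; pose i := Ordinal k0.
rewrite -[leqLHS](size_iota 0).
rewrite -(size_map (fun y => coprod a i * (y%:Z - L%:Z))).
apply: uniq_leq_size => [|x /mapP[y yL ->]].
  rewrite map_inj_uniq ?iota_uniq // => y y' /(mulfI (coprod_neq0 i a0)); lia.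
by apply: mem_dilates; move: yL; rewrite mem_iota; lia.
Qed.

Lemma centred_sum_intr (R : pzRingType) (M n j : nat) (t : j.-tuple 'I_n) :
  centred_sum R M t = (centred_sum int M t)%:~R.
Proof.
by rewrite rmorph_sum; apply: eq_bigr => i _; rewrite rmorphB /= !natz.
Qed.

(** Appending minus its sum to a counted tuple gives integers with sum 0, and dilating them gives a
    solution. The map is injective because the dilation factors are nonzero. *)
Lemma near_count_le_num_solutions (R : realType) (j M L : nat) (w : R)
    (a : 'I_j.+1 -> int) :
  (forall l, a l != 0) -> (M <= L)%N -> w <= L%:R ->
  (near_count M j w 0 <= num_solutions a (dilates a L))%N.
Proof.
move=> a0 ML wL.
pose A := [pred t : j.-tuple 'I_(2 * M + 1) | `|0 - centred_sum R M t| <= w].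
have -> : near_count M j w 0 = #|A|.
  by rewrite -sum1_card [RHS]big_mkcond; apply: eq_bigr => t _;
     rewrite inE; case: ifP.
have s00 : coprod a ord0 * 0 \in dilates a L by apply: mem_dilates.
(* Default value for [insubd], never taken when [t] is in [A]. *)
pose s0 : dilates a L := FSetSub s00.
(* Coordinate [ord0] is the dependent one. In [-L, L], the free coordinates are kept by [M <= L] and
   the dependent one by [w <= L]. *)
pose co (t : j.-tuple 'I_(2 * M + 1)) (i : 'I_j.+1) : int :=
  if unlift ord0 i is Some l then (tnth t l)%:R - M%:R
  else - centred_sum int M t.
pose F t : {ffun 'I_j.+1 -> dilates a L} :=
  [ffun i => insubd s0 (coprod a i * co t i)].
have valF t i : t \in A -> val (F t i) = coprod a i * co t i.
  rewrite inE sub0r normrN centred_sum_intr => /le_trans/(_ wL) sumL.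
  rewrite ffunE insubdK //; apply: mem_dilates; rewrite /co.
  case: unliftP => [l _|_]; last first.
    by rewrite normrN; move: sumL; rewrite -intr_norm -[L%:R]/(L%:~R) ler_int.
  by have := ltn_ord (tnth t l); lia.
rewrite -(card_in_image (f := F)) => [|t t' tA tA' /ffunP FF]; last first.
  apply: eq_from_tnth => l; have := congr1 val (FF (lift ord0 l)).
  rewrite !valF // => /(mulfI (coprod_neq0 _ a0)); rewrite /co liftK.
  by move=> /addIr tt; apply/val_inj => /=; lia.
apply: subset_leq_card; apply/fintype.subsetP => _ /fintype.imageP[t tA ->].
rewrite inE.
under eq_bigr do rewrite valF // mulrA mul_coprod.
rewrite -mulr_sumr (_ : \sum_i co t i = 0) ?mulr0 // big_ord_recl /co.
rewrite unlift_none.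
by under eq_bigr do rewrite liftK; rewrite addNr.
Qed.

(** * Comparison of powers and choice of constants *)

Lemma subrX_le (R : realDomainType) (x y : R) (n : nat) :
  0 <= y <= x -> x ^+ n - y ^+ n <= (x - y) * (n%:R * x ^+ n.-1).
Proof.
(* After factoring out x - y, each of the n remaining products of powers is at most x^(n-1). *)
move=> /andP[y0 yx]; rewrite subrXX ler_wpM2l ?subr_ge0 //.
rewrite mulr_natl -[n in _ *+ n]card_ord -sumr_const ler_sum // => i _.
have -> : x ^+ n.-1 = x ^+ (n.-1 - i) * x ^+ i.
  by rewrite -exprD subnK //; have := ltn_ord i; lia.
have x0 := le_trans y0 yx.
by rewrite ler_wpM2l ?exprn_ge0 // lerXn2r ?nnegrE.
Qed.

Theorem proposition4p3 (R : realType) (k : nat) (hk : (3 <= k)%N) :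
  exists C : R, forall a : 'I_k -> int, (forall i, a i != 0) ->
    forall N : nat, exists S : {fset int},
      (N <= #|` S|)%N /\
      sigma R k / k%:R ^+ (k - 1) * #|` S|%:R ^+ (k - 1)
        - C * #|` S|%:R ^+ (k - 2)
      <= (num_solutions a S)%:R.
Proof.
case: k hk => [//|j] hj; rewrite subn1 subn2 /=.
have sigma0 : 0 <= sigma R j.+1 := (iter_convolution_le_near_count 0 j 0).1.
(* With k = j + 1, n = 2 N + 1 and m = 2 L + 1, the choice L = N + k gives m - n = 2 k. Hence n^j
   falls short of m^j by at most 2 k j m^(j-1), and m <= |S| turns this into the error term. *)
exists (sigma R j.+1 * (2 * j.+1)%:R * j%:R) => a a0 N.
pose L := (N + j.+1)%N; exists (dilates a L).
have s_ge : (2 * L + 1 <= #|` dilates a L|)%N by apply: card_dilates_ge.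
have s_le := card_dilates_le a L.
set s := #|` _| in s_ge s_le *.
split; first by rewrite (leq_trans _ s_ge) // /L; lia.
set n := (2 * N + 1)%N; set m := (2 * L + 1)%N in s_ge s_le.
have T_ge : n%:R ^+ j * sigma R j.+1 <= (num_solutions a (dilates a L))%:R.
  apply: le_trans (iter_convolution_le_near_count N j 0).2 _.
  rewrite mulr0 ler_nat near_count_le_num_solutions //.
    by rewrite /L; lia.
  (* The final window (n + j)/2 equals N + k/2, which is at most L. *)
  by rewrite ler_pdivrMr // -natrM ler_nat /L; lia.
have le_nm : 0 <= (n%:R : R) <= m%:R by rewrite ler0n ler_nat /n /m /L; lia.
have diff : m%:R - n%:R = (2 * j.+1)%:R :> R.
  by rewrite -natrB /n /m /L; [congr _%:R; lia | lia].
have := subrX_le j le_nm; rewrite diff => bern.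
have sj : s%:R ^+ j / j.+1%:R ^+ j <= m%:R ^+ j :> R.
  rewrite ler_pdivrMr ?exprn_gt0 // -exprMn lerXn2r ?nnegrE // -natrM ler_nat.
  by rewrite mulnC.
have sj1 : m%:R ^+ j.-1 <= s%:R ^+ j.-1 :> R.
  by rewrite lerXn2r ?nnegrE // ler_nat.
rewrite -!mulrA -mulrBr [_^-1 * _]mulrC (le_trans _ T_ge) //.
rewrite [leRHS]mulrC ler_wpM2l //.
have := ler_wpM2l (ler0n R (2 * j.+1)) (ler_wpM2l (ler0n R j) sj1).
by move: bern sj; lra.
Qed.
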